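(* Let $G$ be a finite simple graph. For every sequence of pivots $\varphi$ applicable to $G$ there exists a reduced sequence of pivots $\varphi'$ applicable to $G$ with $\sup(\varphi)=\sup(\varphi')$, and therefore $G\varphi=G\varphi'$.
   Context: For a vertex $x$, $N'(x)=N(x)\cup\{x\}$. Pivot: for an edge $\{u,v\}$, let $V_1=N'(u)\setminus N'(v)$, $V_2=N'(v)\setminus N'(u)$, $V_3=N'(u)\cap N'(v)$; $G[uv]$ is obtained by toggling every pair $\{x,y\}$ with $x\in V_i$, $y\in V_j$, $i\neq j$. A sequence $[v_1v_2]\cdots[v_{n-1}v_n]$ is applicable to $G$ if each $\{v_i,v_{i+1}\}$ is an edge of the graph obtained by applying the preceding pivots; $G\varphi$ is the result. The support $\sup(\varphi)=\{v_1\}\oplus\cdots\oplus\{v_n\}$ (symmetric difference) is the set of vertices occurring an odd number of times. A sequence of pivots is reduced if no vertex occurs more than once in it. *)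

(* Defs.v *)
From mathcomp Require Import all_boot.

Set Implicit Arguments.
Unset Strict Implicit.
Unset Printing Implicit Defensive.

(* A finite simple graph is a symmetric irreflexive relation [G : rel T] on a
   finite type of vertices; equality of graphs on [T] is extensional ([=2]). *)

Definition closed_nbhd (T : finType) (G : rel T) (x : T) : {set T} :=
  x |: [set y | G x y].

Definition pivot_part (T : finType) (G : rel T) (u v : T) : 3.-tuple {set T} :=
  [tuple closed_nbhd G u :\: closed_nbhd G v;
         closed_nbhd G v :\: closed_nbhd G u;
         closed_nbhd G u :&: closed_nbhd G v].

Definition toggled (T : finType) (G : rel T) (u v : T) : rel T :=
  fun x y => [exists i : 'I_3, exists j : 'I_3,
    [&& i != j, x \in tnth (pivot_part G u v) i
              & y \in tnth (pivot_part G u v) j]].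

(* Because the neighbourhoods are closed, [u] and [v] both lie in the third
   part, so pivoting also exchanges the neighbourhoods of [u] and [v].
   The value is only meaningful when [G u v]; see [applicable]. *)
Definition pivot (T : finType) (G : rel T) (u v : T) : rel T :=
  fun x y => G x y (+) toggled G u v x y.

(* The sequence [v1 v2][v3 v4]... is encoded as [:: (v1, v2); (v3, v4); ...],
   applied from left to right; it may be empty. *)
Fixpoint apply_pivots (T : finType) (G : rel T) (phi : seq (T * T)) : rel T :=
  if phi is (u, v) :: phi' then apply_pivots (pivot G u v) phi' else G.

Fixpoint applicable (T : finType) (G : rel T) (phi : seq (T * T)) : bool :=
  if phi is (u, v) :: phi' then G u v && applicable (pivot G u v) phi'
  else true.

Definition pivot_vertices (T : finType) (phi : seq (T * T)) : seq T :=
  flatten [seq [:: p.1; p.2] | p <- phi].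

Definition setsymdiff (T : finType) (A B : {set T}) : {set T} :=
  (A :\: B) :|: (B :\: A).

Definition pivot_support (T : finType) (phi : seq (T * T)) : {set T} :=
  \big[@setsymdiff T/set0]_(x <- pivot_vertices phi) [set x].

Definition reduced (T : finType) (phi : seq (T * T)) : bool :=
  uniq (pivot_vertices phi).

Lemma in_pivot_support (T : finType) (phi : seq (T * T)) (x : T) :
  (x \in pivot_support phi) = odd (count_mem x (pivot_vertices phi)).
Proof.
rewrite /pivot_support; elim: (pivot_vertices phi) => [|y s IHs].
  by rewrite big_nil inE.
rewrite big_cons !inE IHs /= oddD oddb eq_sym.
by case: (y == x); case: (odd _).
Qed.

Lemma toggled_sym (T : finType) (G : rel T) (u v : T) :
  symmetric (toggled G u v).
Proof.
move=> x y; apply/idP/idP => /existsP[i /existsP[j /and3P[ne xi yj]]];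
  apply/existsP; exists j; apply/existsP; exists i;
  by rewrite eq_sym ne yj xi.
Qed.

Lemma pivot_sym (T : finType) (G : rel T) (u v : T) :
  symmetric G -> symmetric (pivot G u v).
Proof. by move=> symG x y; rewrite /pivot symG toggled_sym. Qed.

Lemma pivot_irr (T : finType) (G : rel T) (u v : T) :
  irreflexive G -> irreflexive (pivot G u v).
Proof.
move=> irrG x; rewrite /pivot irrG; apply/negbTE/negP.
move=> /existsP[i /existsP[j /and3P[ne]]].
rewrite !(tnth_nth set0) /=.
case: i ne => [[|[|[|i]]] lti] // ne; case: j ne => [[|[|[|j]]] ltj] //= _;
  rewrite ?in_setD ?in_setI;
  by case: (x \in closed_nbhd G u); case: (x \in closed_nbhd G v).
Qed.

(* Main.v *)
Require Import Defs.
From mathcomp Require Import all_boot.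

Set Implicit Arguments.
Unset Strict Implicit.
Unset Printing Implicit Defensive.

(** Over GF(2), pivoting is the principal pivot transform of the adjacency
    matrix: the set of pairs [(x, A x)] of the new graph is obtained from the one
    of the old graph by exchanging the two vectors on the coordinates [u] and
    [v].  Hence a sequence of pivots exchanges the coordinates in its support [X],
    and its result depends on [X] only.  If [X] is nonempty, it contains an edge
    of [G]: otherwise, for [u] in [X], exchanging [(e_u, A e_u)] on [X] would give
    a pair [(0, y)] with [y] nonzero.  Pivoting on such an edge removes its two
    ends from [X], and induction on the size of [X] gives a reduced sequence. *)

Definition adj_image (T : finType) (G : rel T) (x : T -> bool) : T -> bool :=
  fun z => \big[addb/false]_w (G z w && x w).

Definition exchange (T : finType) (X : {set T}) (x y : T -> bool) : T -> bool :=
  fun w => if w \in X then y w else x w.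

(** As a relation between the graphs of two linear maps, this mentions no inverse of the principal
    submatrix on [X], and it is easily composed and reversed. *)
Definition pivot_transform (T : finType) (X : {set T}) (G H : rel T) : Prop :=
  forall x y : T -> bool,
    y =1 adj_image G x <-> exchange X y x =1 adj_image H (exchange X x y).

Lemma eq_adj_image (T : finType) (G : rel T) (x x' : T -> bool) :
  x =1 x' -> adj_image G x =1 adj_image G x'.
Proof. by move=> eqx z; apply: eq_bigr => w _; rewrite eqx. Qed.

Lemma big_addb_pred1 (T : finType) (u : T) (f : T -> bool) :
  \big[addb/false]_w ((w == u) && f w) = f u.
Proof.
rewrite (bigD1 u) //= eqxx big1 ?addbF // => w /negbTE -> //.
Qed.

Lemma adj_image_pred1 (T : finType) (G : rel T) (u : T) :
  adj_image G (pred1 u) =1 G^~ u.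
Proof.
move=> z; rewrite -[RHS](big_addb_pred1 u (G z)).
by apply: eq_bigr => w _; rewrite andbC.
Qed.

Lemma adj_imageD (T : finType) (G : rel T) (x y : T -> bool) (z : T) :
  adj_image G (fun w => x w (+) y w) z = adj_image G x z (+) adj_image G y z.
Proof.
by rewrite -big_split; apply: eq_bigr => w _; rewrite andb_addr.
Qed.

Lemma adj_imageZ (T : finType) (G : rel T) (c : bool) (x : T -> bool) (z : T) :
  adj_image G (fun w => c && x w) z = c && adj_image G x z.
Proof.
by rewrite /adj_image big_distrr; apply: eq_bigr => w _; rewrite andbCA.
Qed.

Lemma exchange_exchange (T : finType) (X Y : {set T}) (x y : T -> bool) :
  exchange X (exchange Y x y) (exchange Y y x) =1 exchange (setsymdiff X Y) x y.
Proof.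
by move=> w; rewrite /exchange !inE; case: (w \in X); case: (w \in Y).
Qed.

Lemma in_closed_nbhd (T : finType) (G : rel T) (u x : T) :
  irreflexive G -> (x \in closed_nbhd G u) = (x == u) (+) G u x.
Proof. by move=> irrG; rewrite !inE; case: eqP => [->|//]; rewrite irrG. Qed.

(* A pair is toggled when the GF(2) vectors of membership of its two ends in the
   closed neighbourhoods of [u] and [v] have nonzero determinant. *)
Lemma toggledE (T : finType) (G : rel T) (u v x y : T) :
  let Nu := closed_nbhd G u in let Nv := closed_nbhd G v in
  toggled G u v x y =
    ((x \in Nu) && (y \in Nv)) (+) ((x \in Nv) && (y \in Nu)).
Proof.
rewrite /toggled /pivot_part /=.
move: (closed_nbhd G u) (closed_nbhd G v) => Nu Nv.
set P := [tuple _; _; _]; apply/idP/idP.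
  move=> /existsP[i /existsP[j /and3P[neij]]]; rewrite !(tnth_nth set0) /=.
  case: i neij => [[|[|[|i]]] lti] // neij;
    case: j neij => [[|[|[|j]]] ltj] //= _; rewrite !inE;
    by case: (x \in Nu); case: (x \in Nv); case: (y \in Nu); case: (y \in Nv).
have ex i j : i < 3 -> j < 3 -> i != j -> x \in nth set0 P i ->
    y \in nth set0 P j ->
    [exists i : 'I_3, exists j : 'I_3, [&& i != j, x \in tnth P i & y \in tnth P j]].
  move=> lti ltj neij xi yj; apply/existsP; exists (Ordinal lti).
  by apply/existsP; exists (Ordinal ltj); rewrite !(tnth_nth set0); apply/and3P.
(* All six ordered pairs of distinct parts are possible witnesses. *)
move: (ex 0 1) (ex 0 2) (ex 1 0) (ex 1 2) (ex 2 0) (ex 2 1).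
rewrite /= !inE.
by case: (x \in Nu); case: (x \in Nv); case: (y \in Nu); case: (y \in Nv) => //=; auto.
Qed.

(** By [toggledE] a pivot adds the matrix $n_u n_v^T + n_v n_u^T$, where $n_u$ is the indicator of
    the closed neighbourhood of [u]; the product $n_v^T x$ is [x v (+) adj_image G x v]. *)
Lemma adj_image_pivot (T : finType) (G : rel T) (u v : T) (x : T -> bool) (z : T) :
  irreflexive G ->
  adj_image (pivot G u v) x z =
    adj_image G x z (+) ((z == u) (+) G u z) && (x v (+) adj_image G x v)
                    (+) ((z == v) (+) G v z) && (x u (+) adj_image G x u).
Proof.
move=> irrG; rewrite /adj_image -(big_addb_pred1 v x) -(big_addb_pred1 u x).
rewrite -!big_split !big_distrr -!big_split; apply: eq_bigr => w _ /=.
rewrite /pivot toggledE !in_closed_nbhd // !andb_addl !andb_addr.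
by rewrite !andb_addl !andbA !addbA.
Qed.

Lemma pivot_transform_pivot (T : finType) (G : rel T) (u v : T) :
  symmetric G -> irreflexive G -> G u v ->
  pivot_transform [set u; v] G (pivot G u v).
Proof.
move=> symG irrG Guv x y.
have neuv : (u == v) = false by apply/eqP => eq_uv; rewrite eq_uv irrG in Guv.
set x' := exchange _ x y; set y' := exchange _ y x.
pose du := x u (+) y u; pose dv := x v (+) y v.
(* Over GF(2), replacing [a] by [b] at a coordinate means adding [a (+) b] there. *)
have exE a b z : exchange [set u; v] a b z =
    a z (+) ((a u (+) b u) && (z == u)) (+) ((a v (+) b v) && (z == v)).
  rewrite /exchange !inE.
  have [-> | _] := eqVneq z u; first by rewrite neuv andbT andbF; case: (a u); case: (b u).
  by have [-> | _] := eqVneq z v; rewrite !(andbT, andbF); case: (a _) => //; case: (b v).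
have imE z : adj_image G x' z =
    adj_image G x z (+) (du && G z u) (+) (dv && G z v).
  rewrite (eq_adj_image _ (exE x y)) !adj_imageD !adj_imageZ.
  by rewrite !(adj_image_pred1 _ _ z).
have xu : x' u = y u by rewrite /x' /exchange !inE eqxx.
have xv : x' v = y v by rewrite /x' /exchange !inE eqxx orbT.
have yu : y' u = x u by rewrite /y' /exchange !inE eqxx.
have yv : y' v = x v by rewrite /y' /exchange !inE eqxx orbT.
have pivE z : adj_image (pivot G u v) x' z = adj_image G x z
    (+) (du && G z u) (+) (dv && G z v)
    (+) ((z == u) (+) G z u) && (y v (+) adj_image G x v (+) du)
    (+) ((z == v) (+) G z v) && (y u (+) adj_image G x u (+) dv).
  rewrite adj_image_pivot // !imE xu xv !irrG (symG v u) Guv (symG u z) (symG v z).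
  by rewrite !(andbT, andbF, addbF) !addbA.
(* Given the old equations at [u] and [v], the neighbourhood terms of [pivE] cancel, and both sides
   of the equation at [z] change by [du] at [u] and by [dv] at [v]. *)
suff eqv z : y u = adj_image G x u -> y v = adj_image G x v ->
    (y z == adj_image G x z) = (y' z == adj_image (pivot G u v) x' z).
  split=> [yE z | y'E].
    by apply/eqP; rewrite -eqv //; apply/eqP.
  (* As [u] and [v] are adjacent, the new equation at [u] reduces to the old one at [v], and vice
     versa. *)
  have yEv : y v = adj_image G x v.
    have := y'E u; rewrite yu pivE eqxx neuv irrG Guv /du /dv.
    by move: (x u) (x v) (y u) (y v) (adj_image _ _ u) (adj_image _ _ v);
      do 6 case.
  have yEu : y u = adj_image G x u.
    have := y'E v; rewrite yv pivE eqxx eq_sym neuv irrG (symG v) Guv /du /dv.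
    by move: (x u) (x v) (y u) (y v) (adj_image _ _ u) (adj_image _ _ v);
      do 6 case.
  by move=> z; apply/eqP; rewrite eqv //; apply/eqP.
move=> yEu yEv; rewrite pivE -yEu -yEv !addbb !addFb /y' exE /du /dv.
move: (y z) (adj_image G x z) (G z u) (G z v) (z == u) (z == v).
by move: (x u) (x v) (y u) (y v); do 10 case.
Qed.

Lemma pivot_transform_trans (T : finType) (X Y : {set T}) (G H K : rel T) :
  pivot_transform X G H -> pivot_transform Y H K ->
  pivot_transform (setsymdiff Y X) G K.
Proof.
move=> GH HK x y; apply: (iff_trans (GH x y)); apply: (iff_trans (HK _ _)).
by split=> E z; have := E z; rewrite (eq_adj_image _ (exchange_exchange _ _ _ _));
  rewrite exchange_exchange.
Qed.

Lemma pivot_transform_sym (T : finType) (X : {set T}) (G H : rel T) :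
  pivot_transform X G H -> pivot_transform X H G.
Proof.
move=> GH x y.
have exK a b : exchange X (exchange X a b) (exchange X b a) =1 a.
  by move=> z; rewrite /exchange; case: (z \in X).
apply: (iff_trans _ (iff_sym (GH (exchange X x y) (exchange X y x)))).
by split=> E z; have := E z; rewrite (eq_adj_image _ (exK _ _)) exK.
Qed.

(** With nothing exchanged, the image of the basis vector at [w] gives column [w] of both adjacency
    matrices. *)
Lemma pivot_transform0 (T : finType) (G H : rel T) :
  pivot_transform set0 G H -> G =2 H.
Proof.
move=> GH z w; have /GH/(_ z) := frefl (adj_image G (pred1 w)).
have ex0 a b : exchange (@set0 T) a b =1 a by move=> t; rewrite /exchange inE.
by rewrite ex0 (eq_adj_image _ (ex0 _ _)) !adj_image_pred1.
Qed.

Lemma pivot_transform_edge (T : finType) (X : {set T}) (G H : rel T) (u : T) :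
  symmetric G -> pivot_transform X G H -> u \in X ->
  exists2 v, v \in X & G u v.
Proof.
move=> symG GH uX; apply/exists_inP; apply: contraT => /exists_inPn noE.
have /GH/(_ u) := frefl (adj_image G (pred1 u)).
rewrite {1}/exchange uX /= eqxx /adj_image big1 // => w _.
(* The exchanged vector is zero: on [X] because [u] has no neighbour there, off [X] because [u] is
   the only vertex where [pred1 u] holds. *)
rewrite /exchange; case: ifPn => [wX | wX].
  by rewrite [X in _ && X]adj_image_pred1 symG (negbTE (noE w wX)) andbF.
by rewrite /=; case: (eqVneq w u) wX => [->|_]; rewrite ?uX ?andbF.
Qed.

Lemma pivot_support_cons (T : finType) (u v : T) (phi : seq (T * T)) :
  u != v -> pivot_support ((u, v) :: phi) =
            setsymdiff (pivot_support phi) [set u; v].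
Proof.
move=> neuv; apply/setP => x; rewrite !inE !in_pivot_support /= !oddD !oddb.
rewrite -/(pivot_vertices phi) ![_ == x]eq_sym.
have [-> | _] := eqVneq x u; first by rewrite (negbTE neuv); case: (odd _).
by case: (x == v); case: (odd _).
Qed.

Lemma pivot_transform_apply (T : finType) (G : rel T) (phi : seq (T * T)) :
  symmetric G -> irreflexive G -> applicable G phi ->
  pivot_transform (pivot_support phi) G (apply_pivots G phi).
Proof.
elim: phi G => [|[u v] phi IH] G symG irrG /=.
  move=> _ x y; have -> : pivot_support [::] = set0 :> {set T}.
    by apply/setP => z; rewrite in_pivot_support inE.
  have ex0 a b : exchange (@set0 T) a b =1 a by move=> t; rewrite /exchange inE.
  by split=> E z; have := E z; rewrite (eq_adj_image _ (ex0 _ _)) ex0.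
case/andP=> Guv app; have neuv : u != v.
  by apply: contraTneq Guv => ->; rewrite irrG.
rewrite pivot_support_cons //; apply: pivot_transform_trans.
  exact: pivot_transform_pivot.
by apply: IH => //; [apply: pivot_sym | apply: pivot_irr].
Qed.

(** The target [H] stays fixed while pivots bring [G] closer to it. Tracking the exact vertex set in
    the induction shows that later pivots avoid [u] and [v]. *)
Lemma pivot_transform_reduced (T : finType) (X : {set T}) (G H : rel T) :
  symmetric G -> irreflexive G -> pivot_transform X G H ->
  exists phi : seq (T * T),
    [/\ reduced phi, applicable G phi, pivot_vertices phi =i X
      & apply_pivots G phi =2 H].
Proof.
have [n] := ubnP #|X|; elim: n X G => // n IH X G ltXn symG irrG GH.
have [X0 | [u uX]] := set_0Vmem X.
  exists [::]; split=> //; first by move=> z; rewrite X0 inE.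
  by apply: pivot_transform0; rewrite -X0.
have [v vX Guv] := pivot_transform_edge symG GH uX.
have neuv : u != v by apply: contraTneq Guv => ->; rewrite irrG.
have defX : setsymdiff X [set u; v] = X :\: [set u; v].
  apply/setP => z; rewrite !inE.
  have [-> | _] := eqVneq z u; first by rewrite uX.
  by have [-> | _] := eqVneq z v; rewrite ?vX /= ?andbF ?orbF.
(* From the pivoted graph one goes back to [G] by exchanging [u] and [v], then on to [H] by
   exchanging [X]. *)
have GuvH : pivot_transform (X :\: [set u; v]) (pivot G u v) H.
  rewrite -defX; apply: pivot_transform_trans GH.
  exact/pivot_transform_sym/pivot_transform_pivot.
have ltD : #|X :\: [set u; v]| < n.
  rewrite -ltnS; apply: leq_trans ltXn; rewrite ltnS; apply: proper_card.
  apply/properP; split; first exact: subsetDl.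
  by exists u; rewrite ?inE ?eqxx.
have [phi [redphi appphi memphi resphi]] :=
  IH _ _ ltD (pivot_sym u v symG) (pivot_irr u v irrG) GuvH.
exists ((u, v) :: phi); split=> /=.
- rewrite /reduced /= -/(pivot_vertices phi) inE !memphi !inE !eqxx orbT.
  by rewrite (negbTE neuv).
- by rewrite Guv.
- move=> z; rewrite !inE -/(pivot_vertices phi) memphi !inE.
  have [-> | _] := eqVneq z u; first by rewrite uX.
  by have [-> | _] := eqVneq z v; rewrite ?vX.
- exact: resphi.
Qed.

Theorem theorem5 (T : finType) (G : rel T)
    (symG : symmetric G) (irrG : irreflexive G)
    (phi : seq (T * T)) (happ : applicable G phi) :
  exists phi' : seq (T * T),
    [/\ reduced phi', applicable G phi', pivot_support phi = pivot_support phi'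
      & apply_pivots G phi =2 apply_pivots G phi'].
Proof.
have tr := pivot_transform_apply symG irrG happ.
have [phi' [red app mem res]] := pivot_transform_reduced symG irrG tr.
exists phi'; split=> //; apply/setP => x.
(* In a reduced sequence, occurring an odd number of times is the same as occurring. *)
by rewrite -mem in_pivot_support count_uniq_mem // oddb.
Qed.
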